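(* Consider minimizing over $\bm{\theta}\in\mathbb{R}^m$ the negative log-likelihood $\mathcal{L}(\bm{\theta})=-\sum_{\bm{x}\in\mathcal{X}}\log P(\bm{x}|\bm{\theta})$, with $P(\bm{x}|\bm{\theta})=\sum_{\bm{y}}P(\bm{x},\bm{y}|\bm{\theta})$, where $P(\bm{x},\bm{y}|\bm{\theta})$ belongs to a natural exponential family with parameter $\bm{\theta}$, and suppose $\mathcal{L}$ has a minimizer $\bm{\theta}^\star$. Let $L$ be a Lipschitz constant of the gradient of $f(\bm{\theta})=N\log\big(\sum_{\bm{x},\bm{y}}\varphi(\bm{x},\bm{y})e^{\langle\bm{\theta},T(\bm{x},\bm{y})\rangle}\big)$. Let $\bm{\theta}^1,\ldots,\bm{\theta}^K$ be a sequence generated by the Block EM algorithm with $n$ blocks. Then $$\min_{k\in\{1,\ldots,K\}}\mathbb{E}\big[\|\nabla\mathcal{L}(\bm{\theta}^k)\|^2\big]\;\le\;\frac{2nL}{K}\big(\mathcal{L}(\bm{\theta}^1)-\mathcal{L}(\bm{\theta}^\star)\big).$$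
   Context: Natural exponential family: $$P(\bm{x},\bm{y}|\bm{\theta})=\frac{\varphi(\bm{x},\bm{y})e^{\langle\bm{\theta},T(\bm{x},\bm{y})\rangle}}{\sum_{\bm{x},\bm{y}}\varphi(\bm{x},\bm{y})e^{\langle\bm{\theta},T(\bm{x},\bm{y})\rangle}},$$ where $\varphi>0$ is the base measure and $T(\bm{x},\bm{y})\in\mathbb{R}^m$ the sufficient statistic; $\bm{x}$ (observed) and $\bm{y}$ (hidden) range over discrete sets, and all sums involved are assumed to converge. $\mathcal{X}$ is a dataset of $N$ observed points. One has $\mathcal{L}=f-h$ with $f$ as in the claim and $h(\bm{\theta})=\sum_{\bm{x}\in\mathcal{X}}\log\big(\sum_{\bm{y}}\varphi(\bm{x},\bm{y})e^{\langle\bm{\theta},T(\bm{x},\bm{y})\rangle}\big)$; both are convex and smooth, and $f$ is $L$-smooth: $\|\nabla f(\bm{\theta})-\nabla f(\bm{\theta}')\|\le L\|\bm{\theta}-\bm{\theta}'\|$ for all $\bm{\theta},\bm{\theta}'$ (Euclidean norms). The coordinates of $\bm{\theta}\in\mathbb{R}^m$ are partitioned into $n$ non-overlapping blocks $\theta_1,\dots,\theta_n$. Block EM algorithm: start from a deterministic $\bm{\theta}^1$. For $k=1,\dots,K$: draw $i_k$ uniformly from $\{1,\dots,n\}$, independently of the past; for each $\bm{x}\in\mathcal{X}$ set $\hat P^{k+1}(\bm{y})=P(\bm{x},\bm{y}|\bm{\theta}^k)/\sum_{\bm{y}}P(\bm{x},\bm{y}|\bm{\theta}^k)$ (this is the posterior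 $P(\bm{y}|\bm{x},\bm{\theta}^k)$, depending on $\bm{x}$); let $$\theta^{k+1}_{i_k}\in\arg\min_{\theta_{i_k}}\;-\sum_{\bm{x}\in\mathcal{X},\bm{y}}\hat P^{k+1}(\bm{y})\log P(\bm{x},\bm{y}|\theta_1^k,\dots,\theta_{i_k},\dots,\theta_n^k)$$ (unconstrained; a minimizer is assumed to exist), and let $\bm{\theta}^{k+1}$ be $\bm{\theta}^k$ with block $i_k$ replaced by $\theta^{k+1}_{i_k}$. $\mathbb{E}$ is the expectation over the random block choices. *)

(* Defs.v *)
From HB Require Import structures.
From mathcomp Require Import all_boot all_order all_algebra.
From mathcomp Require Import all_classical all_reals all_analysis.

Set Implicit Arguments.
Unset Strict Implicit.
Unset Printing Implicit Defensive.

Import Order.TTheory GRing.Theory Num.Theory.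
Import numFieldNormedType.Exports.

Local Open Scope classical_set_scope.
Local Open Scope ring_scope.

(* The norm of the library on 'rV[R]_m is the sup norm, hence [enorm]. The
   topology is the same, and so are the derivatives 'D_v. *)
Definition dotp (R : realType) (m : nat) (u v : 'rV[R]_m) : R :=
  \sum_(c < m) u 0 c * v 0 c.

Definition enorm (R : realType) (m : nat) (u : 'rV[R]_m) : R :=
  Num.sqrt (dotp u u).

Definition grad (R : realType) (m : nat) (g : 'rV[R]_m -> R) (t : 'rV[R]_m) :
    'rV[R]_m :=
  \row_(c < m) 'D_(delta_mx 0 c) g t.

Definition lipschitz_gradient (R : realType) (m : nat) (L : R)
    (g : 'rV[R]_m -> R) : Prop :=
  forall s t, enorm (grad g s - grad g t) <= L * enorm (s - t).

(* [\esum] is meant for nonnegative terms, so that a signed family is summed as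
   positive part minus negative part. The value is meaningful only when
   [converges u] holds; as there is no preferred order on [S], convergence is
   unconditional, i.e. absolute. *)
Definition converges (R : realType) (S : choiceType) (u : S -> R) : Prop :=
  summable [set: S] (fun s => (u s)%:E).

Definition csum (R : realType) (S : choiceType) (u : S -> R) : R :=
  fine (\esum_(s in [set: S]) (Num.max (u s) 0)%:E)
  - fine (\esum_(s in [set: S]) (Num.max (- u s) 0)%:E).

Section exponential_family.
Context {R : realType} {m : nat} {X Y : countType}.
Variables (phi : X -> Y -> R) (stat : X -> Y -> 'rV[R]_m).

Definition weight (t : 'rV[R]_m) (x : X) (y : Y) : R :=
  phi x y * expR (dotp t (stat x y)).

Definition partition_function (t : 'rV[R]_m) : R :=
  csum (fun xy : X * Y => weight t xy.1 xy.2).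

Definition joint (t : 'rV[R]_m) (x : X) (y : Y) : R :=
  weight t x y / partition_function t.

Definition marginal (t : 'rV[R]_m) (x : X) : R := csum (joint t x).

Definition posterior (t : 'rV[R]_m) (x : X) (y : Y) : R :=
  joint t x y / marginal t x.

(* A dataset is a tuple, as the same point may be observed several times. *)
Definition nll (N : nat) (data : N.-tuple X) (t : 'rV[R]_m) : R :=
  - \sum_(x <- data) ln (marginal t x).

Definition flog (N : nat) (t : 'rV[R]_m) : R :=
  N%:R * ln (partition_function t).

Definition em_objective (N : nat) (data : N.-tuple X) (t s : 'rV[R]_m) : R :=
  - \sum_(x <- data) csum (fun y => posterior t x y * ln (joint s x y)).

Definition same_outside (n : nat) (block : 'I_m -> 'I_n) (j : 'I_n)
    (t s : 'rV[R]_m) : Prop :=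
  forall c, block c != j -> s 0 c = t 0 c.

(* [t'] is [t] with block [j] replaced by a minimizer; the minimizer need not
   be unique, and [t'] is any of the possible outcomes. *)
Definition block_em_step (N : nat) (data : N.-tuple X) (n : nat)
    (block : 'I_m -> 'I_n) (j : 'I_n) (t t' : 'rV[R]_m) : Prop :=
  same_outside block j t t' /\
  forall s, same_outside block j t s ->
    em_objective data t t' <= em_objective data t s.

End exponential_family.

(* The events generated by theta^1, ..., theta^k and i_1, ..., i_(k-1). *)
Definition past {d : measure_display} {Omega : measurableType d} {R : realType}
    (m n : nat) (theta : nat -> Omega -> 'rV[R]_m) (draw : nat -> Omega -> 'I_n)
    (k : nat) : set (set Omega) :=
  <<s [set A | (exists l U, [/\ (1 <= l <= k)%N, open U &
                              A = theta l @^-1` U])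
            \/ (exists l j, (1 <= l < k)%N /\ A = draw l @^-1` [set j])] >>.

(* Run of K iterations, producing theta^1, ..., theta^(K+1). The choice among
   several minimizers is free: it may use extra randomness, as long as the next
   draw stays independent of the past. *)
Record block_em_run {d : measure_display} {Omega : measurableType d}
    {R : realType} (P : probability Omega R) (m : nat) (X Y : countType)
    (phi : X -> Y -> R) (stat : X -> Y -> 'rV[R]_m) (N : nat)
    (data : N.-tuple X) (n : nat) (block : 'I_m -> 'I_n) (K : nat)
    (theta1 : 'rV[R]_m) (theta : nat -> Omega -> 'rV[R]_m)
    (draw : nat -> Omega -> 'I_n) : Prop := BlockEMRun {
  run_start : forall w, theta 1 w = theta1 ;
  run_theta_measurable : forall k (U : set 'rV[R]_m),
    (1 <= k <= K.+1)%N -> open U -> measurable (theta k @^-1` U) ;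
  run_draw_measurable : forall k j,
    (1 <= k <= K)%N -> measurable (draw k @^-1` [set j]) ;
  run_draw_uniform : forall k j,
    (1 <= k <= K)%N -> P (draw k @^-1` [set j]) = (n%:R^-1)%:E ;
  run_draw_independent : forall k j A,
    (1 <= k <= K)%N -> past theta draw k A ->
    P (A `&` draw k @^-1` [set j]) = (P A * P (draw k @^-1` [set j]))%E ;
  run_step : forall k w,
    (1 <= k <= K)%N ->
    block_em_step phi stat data block (draw k w) (theta k w) (theta k.+1 w)
}.

(* Main.v *)
Require Import Defs.
From HB Require Import structures.
From mathcomp Require Import all_boot all_order all_algebra.
From mathcomp Require Import all_classical all_reals all_analysis.
From mathcomp Require Import measurable_realfun ring lra.

Set Implicit Arguments.
Unset Strict Implicit.
Unset Printing Implicit Defensive.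

Import Order.TTheory GRing.Theory Num.Theory.
Import numFieldNormedType.Exports.

Local Open Scope classical_set_scope.
Local Open Scope ring_scope.

(* Write nll = f - h. The objective of the M-step at t is, up to a constant,
   s |-> f s - <grad h t, s>, and h lies above its tangent at t because h is a
   sum of log-sum-exp functions. Hence nll decreases along the M-step at least
   as much as this objective, and, by exact minimization over the block, at
   least as much as along the gradient step of length 1/L in the block. By the
   descent lemma for f,
     |grad_(i_k) nll(theta^k)|^2 <= 2 L (nll(theta^k) - nll(theta^(k+1)))
   pathwise. This telescopes over k, and averaging over the uniform draw i_k,
   independent of theta^k, turns the left-hand side into 1/n times the squared
   norm of the full gradient. *)

(** * Unconditional sums of signed families *)

Lemma esumZl (R : realType) (S : choiceType) (u : S -> \bar R) (r : R) :
    (0 <= r)%R -> (forall s, 0 <= u s)%E ->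
  (\esum_(s in [set: S]) (r%:E * u s) = r%:E * \esum_(s in [set: S]) u s)%E.
Proof.
move=> r0 u0; rewrite /esum -ereal_supZl//; last first.
  by apply/set0P; exists 0%E; exists set0; [exact: fsets_set0|rewrite fsbig_set0].
congr ereal_sup; rewrite image_comp; apply: eq_imagel => A _.
by rewrite /= ge0_mule_fsumr.
Qed.

Section csum_theory.
Context {R : realType} {S : choiceType}.
Implicit Types (u v : S -> R) (r : R).

Lemma converges_le u v :
  (forall s, `|u s| <= v s) -> converges v -> converges u.
Proof.
move=> uv; apply: le_lt_trans; apply: le_esum => s _.
by rewrite !abse_EFin lee_fin (le_trans (uv s))// ler_norm.
Qed.

Lemma converges_norm u : converges u -> converges (fun s => `|u s|).
Proof. by apply: le_lt_trans; apply: le_esum => s _; rewrite /= normr_id. Qed.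

Lemma convergesD u v :
  converges u -> converges v -> converges (fun s => u s + v s).
Proof. exact: summableD. Qed.

Lemma convergesN u : converges u -> converges (fun s => - u s).
Proof. by rewrite {1}/converges summableN. Qed.

Lemma convergesB u v :
  converges u -> converges v -> converges (fun s => u s - v s).
Proof. exact: summableB. Qed.

Lemma esum_EFin_fin_num u : (forall s, 0 <= u s) ->
  converges u -> \esum_(s in [set: S]) (u s)%:E \is a fin_num.
Proof.
rewrite /converges summableE => u0.
by congr (_ \is a fin_num); apply: eq_esum => s _; rewrite gee0_abs ?lee_fin.
Qed.

(** Subtracting two convergent nonnegative families gives the same value as splitting their
    difference into positive and negative parts. Linearity of [csum] can thus be proved with any
    convenient decomposition. *)
Lemma csum_sub u v : (forall s, 0 <= u s) -> (forall s, 0 <= v s) ->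
  converges u -> converges v ->
  csum (fun s => u s - v s) =
  fine (\esum_(s in [set: S]) (u s)%:E) - fine (\esum_(s in [set: S]) (v s)%:E).
Proof.
move=> u0 v0 cu cv; have cuv := convergesB cu cv.
have pos (w : S -> R) : converges w -> converges (fun s => Num.max (w s) 0).
  move=> cw; apply: (converges_le _ (converges_norm cw)) => s.
  by rewrite ger0_norm ?le_max ?lexx ?orbT// ge_max ler_norm normr_ge0.
have := @esumB R S setT (fun s => (u s)%:E) (fun s => (v s)%:E) cu cv.
have -> : ((fun s => (u s)%:E) \- (fun s => (v s)%:E))%E =
          (fun s => (u s - v s)%:E) by [].
move=> /(_ _ _)/=; rewrite /csum.
have -> : (\esum_(i in [set: S]) ((fun s => (u s - v s)%:E)^\+ i)%E)%E =
          (\esum_(i in [set: S]) (Num.max (u i - v i) 0)%:E)%E.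
  by apply: eq_esum => s _; rewrite funeposE/= EFin_max.
have -> : (\esum_(i in [set: S]) ((fun s => (u s - v s)%:E)^\- i)%E)%E =
          (\esum_(i in [set: S]) (Num.max (- (u i - v i)) 0)%:E)%E.
  by apply: eq_esum => s _; rewrite funenegE/= EFin_max.
move=> E; rewrite -!fineB ?E//.
- by move=> s _; rewrite lee_fin.
- by move=> s _; rewrite lee_fin.
- exact: esum_EFin_fin_num.
- exact: esum_EFin_fin_num.
- by apply: esum_EFin_fin_num (pos _ cuv) => s; rewrite le_max lexx orbT.
- apply: esum_EFin_fin_num (pos _ (convergesN cuv)) => s.
  by rewrite le_max lexx orbT.
Qed.

Lemma csum_ge0E u : (forall s, 0 <= u s) ->
  csum u = fine (\esum_(s in [set: S]) (u s)%:E).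
Proof.
move=> u0; rewrite /csum (eq_esum (b := fun s => (u s)%:E)) => [|s _].
  rewrite [X in _ - fine X]esum1 ?subr0// => s _; congr EFin.
  by apply/max_idPr; rewrite oppr_le0.
by congr EFin; apply/max_idPl.
Qed.

Lemma csum_posneg u : exists p q : S -> R, [/\ forall s, 0 <= p s, forall s, 0 <= q s,
  u = (fun s => p s - q s) & converges u -> converges p /\ converges q].
Proof.
exists (fun s => Num.max (u s) 0), (fun s => Num.max (- u s) 0); split.
- by move=> s; rewrite le_max lexx orbT.
- by move=> s; rewrite le_max lexx orbT.
- apply/funext => s; case: (leP (u s) 0) => us.
    by rewrite max_l ?oppr_ge0// sub0r opprK.
  by rewrite max_r ?subr0// oppr_le0 ltW.
move=> cu; split; apply: (converges_le _ (converges_norm cu)) => s;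
  rewrite ger0_norm ?le_max ?lexx ?orbT// ge_max normr_ge0 ?andbT ?ler_norm//;
  by rewrite -normrN ler_norm.
Qed.

Lemma csumD u v : converges u -> converges v ->
  csum (fun s => u s + v s) = csum u + csum v.
Proof.
move=> cu cv.
have [p [q [p0 q0 uE /(_ cu)[cp cq]]]] := csum_posneg u.
have [p' [q' [p'0 q'0 vE /(_ cv)[cp' cq']]]] := csum_posneg v.
have -> : (fun s => u s + v s) = (fun s => (p s + p' s) - (q s + q' s)).
  by apply/funext => s; rewrite uE vE; ring.
rewrite csum_sub//; try by [move=> s; rewrite addr_ge0|exact: convergesD].
rewrite uE vE !csum_sub//.
have EE (f g : S -> R) : (forall s, 0 <= f s) -> (forall s, 0 <= g s) ->
    converges f -> converges g ->
    fine (\esum_(s in [set: S]) (f s + g s)%:E)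
    = fine (\esum_(s in [set: S]) (f s)%:E) + fine (\esum_(s in [set: S]) (g s)%:E).
  move=> f0 g0 cf cg; rewrite -fineD ?esum_EFin_fin_num// -esumD// => s _.
    by rewrite lee_fin.
  by rewrite lee_fin.
by rewrite (EE p p')// (EE q q')// opprD addrACA.
Qed.

Lemma csumN u : converges u -> csum (fun s => - u s) = - csum u.
Proof.
by move=> cu; rewrite /csum opprB; under [X in _ - fine X]eq_esum do rewrite opprK.
Qed.

Lemma csumB u v : converges u -> converges v ->
  csum (fun s => u s - v s) = csum u - csum v.
Proof. by move=> cu cv; rewrite csumD ?csumN//; exact: convergesN. Qed.

Lemma csum_ge0 u : (forall s, 0 <= u s) -> 0 <= csum u.
Proof.
by move=> u0; rewrite csum_ge0E// fine_ge0// esum_ge0// => s _; rewrite lee_fin.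
Qed.

Lemma le_csum u v : converges u -> converges v ->
  (forall s, u s <= v s) -> csum u <= csum v.
Proof.
move=> cu cv uv; rewrite -subr_ge0 -csumB//.
by apply: csum_ge0 => s; rewrite subr_ge0.
Qed.

Lemma convergesZ u r : converges u -> converges (fun s => r * u s).
Proof.
move=> cu; rewrite /converges /summable.
have -> : (\esum_(s in [set: S]) `|(r * u s)%:E| =
           `|r|%:E * \esum_(s in [set: S]) `|(u s)%:E|)%E.
  rewrite -esumZl//; apply: eq_esum => s _.
  by rewrite EFinM abseM.
by rewrite lte_mul_pinfty// lee_fin.
Qed.

Lemma csumZ u r : converges u -> csum (fun s => r * u s) = r * csum u.
Proof.
move=> cu; wlog r0 : r / 0 <= r => [hw|].
  have [r0|/ltW r0] := leP 0 r; first exact: hw.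
  rewrite -[in RHS](opprK r) mulNr -hw ?oppr_ge0//.
  rewrite -csumN; last exact: convergesZ.
  by congr csum; apply/funext => s; rewrite mulNr opprK.
have [p [q [p0 q0 uE /(_ cu)[cp cq]]]] := csum_posneg u.
rewrite uE; under [in LHS]eq_fun do rewrite mulrBr.
have E (f : S -> R) : (forall s, 0 <= f s) -> converges f ->
      csum (fun s => r * f s) = r * csum f.
  move=> f0 cf; rewrite !csum_ge0E//; last by move=> s; rewrite mulr_ge0.
  under eq_esum do rewrite EFinM.
  rewrite esumZl//.
  rewrite fineM//.
  exact: esum_EFin_fin_num.
rewrite !csumB//; try exact: convergesZ.
by rewrite !E// [RHS]mulrBr.
Qed.

(** The sum dominates its single term at [s0]. This yields positive normalizing constants, so that
    logarithms and quotients make sense. *)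
Lemma csum_gt0 u s0 : converges u -> (forall s, 0 <= u s) -> 0 < u s0 ->
  0 < csum u.
Proof.
move=> cu u0 us0; apply: (lt_le_trans us0).
rewrite csum_ge0E// -lee_fin fineK ?esum_EFin_fin_num//.
rewrite -(@esum_set1 _ _ s0 (fun s => (u s)%:E)) ?lee_fin//.
rewrite [leRHS](esumID [set s0])//; last by move=> s _; rewrite lee_fin.
by rewrite setTI leeDl// esum_ge0// => s _; rewrite lee_fin.
Qed.

End csum_theory.

(** The pairs with first component [x] are in bijection with [Y], so the slice is a subfamily of the
    whole. *)
Lemma converges_slice (R : realType) (X Y : choiceType) (u : X * Y -> R) x :
  converges u -> converges (fun y => u (x, y)).
Proof.
apply: le_lt_trans.
rewrite [leRHS](esumID [set xy | xy.1 = x])//.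
rewrite setTI (reindex_esum setT [set xy | xy.1 = x] (fun y => (x, y)))//; last first.
  split=> [y _ //|y y' _ _ [] //|[x' y]/= ->]; first by exists y.
by rewrite leeDl// esum_ge0.
Qed.

(** * Euclidean inner product and norm *)

Section dotp_theory.
Context {R : realType} {m : nat}.
Implicit Types (u v t : 'rV[R]_m) (r : R).

Lemma dotpC u v : dotp u v = dotp v u.
Proof. by apply: eq_bigr => c _; rewrite mulrC. Qed.

Lemma dotpDl u v t : dotp (u + v) t = dotp u t + dotp v t.
Proof. by rewrite -big_split; apply: eq_bigr => c _; rewrite mxE mulrDl. Qed.

Lemma dotpZl r u t : dotp (r *: u) t = r * dotp u t.
Proof. by rewrite mulr_sumr; apply: eq_bigr => c _; rewrite mxE mulrA. Qed.

Lemma dotp0l t : dotp 0 t = 0.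
Proof. by rewrite -[X in dotp X](scale0r t) dotpZl mul0r. Qed.

Lemma dotpNl u t : dotp (- u) t = - dotp u t.
Proof. by rewrite -scaleN1r dotpZl mulN1r. Qed.

Lemma dotpBl u v t : dotp (u - v) t = dotp u t - dotp v t.
Proof. by rewrite dotpDl dotpNl. Qed.

Lemma dotpDr u v t : dotp t (u + v) = dotp t u + dotp t v.
Proof. by rewrite !(dotpC t) dotpDl. Qed.

Lemma dotpZr r u t : dotp t (r *: u) = r * dotp t u.
Proof. by rewrite !(dotpC t) dotpZl. Qed.

Lemma dotpBr u v t : dotp t (u - v) = dotp t u - dotp t v.
Proof. by rewrite !(dotpC t) dotpBl. Qed.

Lemma dotp_delta c t : dotp (delta_mx 0 c) t = t 0 c.
Proof.
rewrite /dotp (bigD1 c)//= big1 => [|i /negPf ic].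
  by rewrite mxE !eqxx mul1r addr0.
by rewrite mxE ic andbF mul0r.
Qed.

Lemma dotpp_ge0 u : 0 <= dotp u u.
Proof. by apply: sumr_ge0 => c _; rewrite -expr2 sqr_ge0. Qed.

Lemma dotpp_eq0 u : dotp u u = 0 -> u = 0.
Proof.
move=> /eqP; rewrite psumr_eq0 => [/allP u0|c _]; last by rewrite -expr2 sqr_ge0.
apply/rowP => c; rewrite mxE; apply/eqP.
by have := u0 c; rewrite mem_index_enum mulf_eq0 orbb; apply.
Qed.

Lemma enorm_sqr u : enorm u ^+ 2 = dotp u u.
Proof. by rewrite sqr_sqrtr// dotpp_ge0. Qed.

Lemma enormZ r u : enorm (r *: u) = `|r| * enorm u.
Proof.
by rewrite /enorm dotpZl dotpZr mulrA -expr2 sqrtrM ?sqr_ge0// sqrtr_sqr.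
Qed.

(** Cauchy-Schwarz, by expanding the squared norm of [dotp v v *: u - dotp u v *: v]; the scaling
    avoids a division. *)
Lemma dotp_le_enorm u v : dotp u v <= enorm u * enorm v.
Proof.
have [v0|v0] := eqVneq (dotp v v) 0.
  by rewrite (dotpp_eq0 v0) dotpC dotp0l mulr_ge0// sqrtr_ge0.
have {}v0 : 0 < dotp v v by rewrite lt_def v0 dotpp_ge0.
have /= := dotpp_ge0 (dotp v v *: u - dotp u v *: v).
rewrite dotpBl !dotpBr !dotpZl !dotpZr (dotpC v u) => H.
rewrite (le_trans (ler_norm _))// -ler_sqr ?nnegrE ?mulr_ge0 ?sqrtr_ge0//.
rewrite exprMn !enorm_sqr real_normK ?num_real//.
rewrite -(ler_pM2r v0); nra.
Qed.

End dotp_theory.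

(** * Directional derivatives as one-variable derivatives *)

Section directional_derivative.
Context {R : realType} {m : nat}.
Implicit Types (t v : 'rV[R]_m) (g : 'rV[R]_m -> R).

(** Both sides have the same difference quotient. Through this the one-variable chain rule and the
    mean value theorem apply along lines. *)
Lemma is_derive_line g t v h l :
  is_derive h (1 : R) (fun k : R => g (t + k *: v)) l <->
  is_derive (t + h *: v) v g l.
Proof.
pose F (k : R) := g (t + k *: v); rewrite -/F.
have E k : F (k *: 1 + h) = g (k *: v + (t + h *: v)).
  by rewrite /F [k *: 1]mulr1 scalerDl addrCA.
have dE : derivable F h 1 = derivable g (t + h *: v) v.
  rewrite /derivable; set q1 := fun k => k^-1 *: _; set q2 := fun k => k^-1 *: _.
  suff -> : q1 = q2 by [].
  by apply/funext => k; rewrite /q1 /q2 /= E.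
have DE : 'D_1 F h = 'D_v g (t + h *: v).
  rewrite /derive; set q1 := fun k => k^-1 *: _; set q2 := fun k => k^-1 *: _.
  suff -> : q1 = q2 by [].
  by apply/funext => k; rewrite /q1 /q2 /= E.
split=> -[dF <-]; constructor.
- by rewrite -dE.
- by rewrite DE.
- by rewrite dE.
- by rewrite DE.
Qed.

(** Reads a derivative off a remainder estimate, which for a series can be obtained by summing
    termwise estimates. *)
Lemma is_derive_quadratic g t v l C :
    (forall h, `|h| <= 1 -> `|g (t + h *: v) - g t - h * l| <= C * h ^+ 2) ->
  is_derive t v g l.
Proof.
move=> gC.
suff gl : (fun h : R => h^-1 *: ((g \o shift t) (h *: v) - g t)) @ 0^' --> l.
  by constructor; [apply/cvg_ex; exists l|apply/cvg_lim].
apply/cvgrPdist_le => e e0; near=> h.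
have h0 : h != 0 by near: h; exact: nbhs_dnbhs_neq.
(* The sign of [C] is not known and [C] may vanish, hence the denominator |C| + 1. *)
have h1 : `|h| <= Num.min 1 (e / (`|C| + 1)).
  near: h; apply: dnbhs0_le.
  by rewrite lt_min ltr01 divr_gt0// ltr_pwDr.
move: h1; rewrite le_min ler_pdivlMr ?ltr_pwDr// => /andP[h1 hC].
rewrite /= distrC [h *: v + t]addrC.
have -> : h^-1 *: (g (t + h *: v) - g t) - l = h^-1 * (g (t + h *: v) - g t - h * l).
  by rewrite mulrBr mulKf.
rewrite normrM normfV ler_pdivrMl ?normr_gt0//.
apply: (le_trans (gC _ h1)); rewrite -real_normK ?num_real// expr2 mulrCA.
apply: ler_wpM2l => //; apply: le_trans hC; rewrite [leRHS]mulrC.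
apply: ler_wpM2r => //.
by rewrite (le_trans (ler_norm C))// lerDl.
Unshelve. all: by end_near. Qed.

End directional_derivative.

(** * Elementary bounds on the exponential *)

Section expR_bounds.
Context {R : realType}.
Implicit Types (a h x : R).

(** Rearranging [expR x * (1 - x) <= 1] bounds the left side by [x * (expR x - 1)]. It remains to
    use [expR x - 1 <= x * expR x] for x >= 0, and [expR x - 1 >= x] for x < 0. *)
Lemma expR_sub1_le x : expR x - 1 - x <= x ^+ 2 * expR `|x|.
Proof.
have e0 := expR_gt0 x; have e1 := expR_ge1Dx x.
have e2 : expR x * (1 - x) <= 1.
  by rewrite -ler_pdivlMl// mulr1 -expRN expR_ge1Dx.
have [x0|x0] := leP 0 x; first by rewrite ger0_norm//; nra.
have : 1 <= expR `|x| by rewrite -expR0 ler_expR.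
by nra.
Qed.

(** Square the bound 1 + |a|/2 <= exp(|a|/2). *)
Lemma sqr_le_expR_norm a : a ^+ 2 <= 4 * expR `|a|.
Proof.
have -> : `|a| = `|a| / 2 + `|a| / 2 by lra.
have := expR_ge1Dx (`|a| / 2); rewrite expRD -(real_normK (num_real a)).
by have := normr_ge0 a; nra.
Qed.

Lemma expR_norm_le a : expR `|a| <= expR a + expR (- a).
Proof.
by have [a0|a0] := leP 0 a; [rewrite ger0_norm// lerDl|rewrite ltr0_norm// lerDr];
  exact: expR_ge0.
Qed.

(* The bound is summable against the weights of an exponential family that
   converges everywhere, so that the series can be differentiated termwise
   without a dominated convergence theorem. *)
Lemma expR_quadratic a h : `|h| <= 1 ->
  `|expR (h * a) - 1 - h * a| <=
  4 * (expR (2 * a) + expR (- (2 * a))) * h ^+ 2.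
Proof.
move=> h1; rewrite ger0_norm; last first.
  by have := expR_ge1Dx (h * a); lra.
apply: (le_trans (expR_sub1_le _)); rewrite exprMn -[leLHS]mulrA [leRHS]mulrC.
apply: ler_wpM2l; first exact: sqr_ge0.
have ha : expR `|h * a| <= expR `|a|.
  by rewrite ler_expR normrM; apply: ler_piMl.
apply: (le_trans (ler_wpM2l (sqr_ge0 _) ha)).
apply: (le_trans (ler_wpM2r (expR_ge0 _) (sqr_le_expR_norm a))).
have -> : 4 * expR `|a| * expR `|a| = 4 * expR `|2 * a|.
  have -> : `|2 * a| = `|a| + `|a| by rewrite normrM normr_nat mulr_natl mulr2n.
  by rewrite expRD mulrA.
apply: ler_wpM2l => //.
exact: expR_norm_le.
Qed.

End expR_bounds.

Lemma is_derive_quadratic_poly (R : realType) (a b h : R) :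
  is_derive h 1 (fun k : R => k * a + k ^+ 2 * b) (a + 2 * h * b).
Proof.
have d1 : is_derive h 1 (fun k : R => k) 1 by exact: is_derive_id.
have d3 := is_deriveD (is_deriveZ a d1) (is_deriveZ b (is_deriveM d1 d1)).
have -> : (fun k : R => k * a + k ^+ 2 * b) =
    a *: (fun k : R => k) + b *: ((fun k : R => k) * (fun k : R => k)).
  apply/funext => k; rewrite expr2 mulrC [_ * b]mulrC; reflexivity.
apply: (@is_derive_eq _ _ _ _ _ _ _ _ d3).
rewrite /GRing.scale/=.
by ring.
Qed.

(** * Gradients, subgradients and the descent lemma *)

Section gradients.
Context {R : realType} {m : nat}.
Implicit Types (g f : 'rV[R]_m -> R) (G F : 'rV[R]_m -> 'rV[R]_m).

(** Differentiability in the sense of Gateaux, with a derivative linear in the direction: enough for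
    arguments along lines and stable under linear combinations. *)
Definition has_gradient g G := forall t v, is_derive t v g (dotp (G t) v).

Definition subgradient g G := forall t s, g t + dotp (G t) (s - t) <= g s.

Lemma has_gradient_grad g G t : has_gradient g G -> grad g t = G t.
Proof.
move=> gG; apply/rowP => c; rewrite mxE.
by rewrite (@derive_val _ _ _ _ _ _ _ (gG t _)) dotpC dotp_delta.
Qed.

Lemma has_gradientD f g F G : has_gradient f F -> has_gradient g G ->
  has_gradient (fun t => f t + g t) (fun t => F t + G t).
Proof. by move=> fF gG t v; rewrite dotpDl; exact: is_deriveD. Qed.

Lemma has_gradientZ r g G : has_gradient g G ->
  has_gradient (fun t => r * g t) (fun t => r *: G t).
Proof. by move=> gG t v; rewrite dotpZl; exact: is_deriveZ. Qed.

Lemma has_gradientB f g F G : has_gradient f F -> has_gradient g G ->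
  has_gradient (fun t => f t - g t) (fun t => F t - G t).
Proof. by move=> fF gG t v; rewrite dotpBl; exact: is_deriveB. Qed.

Lemma has_gradient_sum (I : Type) (r : seq I) (g : I -> 'rV[R]_m -> R)
    (G : I -> 'rV[R]_m -> 'rV[R]_m) :
  (forall i, has_gradient (g i) (G i)) ->
  has_gradient (fun t => \sum_(i <- r) g i t) (fun t => \sum_(i <- r) G i t).
Proof.
move=> gG; elim: r => [|i r IH].
  rewrite (_ : (fun t => _) = cst 0); last by apply/funext => t; rewrite big_nil.
  by move=> t v; rewrite big_nil dotp0l; exact: is_derive_cst.
rewrite (_ : (fun t => _) = (fun t => g i t + \sum_(j <- r) g j t)); last first.
  by apply/funext => t; rewrite big_cons.
rewrite (_ : (fun t => \sum_(j <- _) G j t) =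
    (fun t => G i t + \sum_(j <- r) G j t)); last first.
  by apply/funext => t; rewrite big_cons.
exact: has_gradientD.
Qed.

Lemma subgradientZ r g G : 0 <= r -> subgradient g G ->
  subgradient (fun t => r * g t) (fun t => r *: G t).
Proof.
by move=> r0 gG t s; rewrite dotpZl -mulrDr; apply: ler_wpM2l => //; exact: gG.
Qed.

Lemma subgradient_sum (I : Type) (r : seq I) (g : I -> 'rV[R]_m -> R)
    (G : I -> 'rV[R]_m -> 'rV[R]_m) :
  (forall i, subgradient (g i) (G i)) ->
  subgradient (fun t => \sum_(i <- r) g i t) (fun t => \sum_(i <- r) G i t).
Proof.
move=> gG t s; elim: r => [|i r IH].
  by rewrite !big_nil dotp0l addr0.
by rewrite !big_cons dotpDl addrACA lerD//; exact: gG.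
Qed.

Lemma descent_lemma g G L : 0 <= L -> has_gradient g G ->
  (forall s t, enorm (G s - G t) <= L * enorm (s - t)) ->
  forall t v, g (t + v) <= g t + dotp (G t) v + L / 2 * enorm v ^+ 2.
Proof.
move=> L0 gG GL t v.
(* The claim is q(1) <= q(0). By the mean value theorem it suffices that dq <= 0 on ]0, 1[, which is
   Cauchy-Schwarz followed by the Lipschitz bound. *)
pose q (h : R) := g (t + h *: v) -
  (h * dotp (G t) v + h ^+ 2 * (L / 2 * enorm v ^+ 2)).
pose dq (h : R) := dotp (G (t + h *: v)) v -
  (dotp (G t) v + 2 * h * (L / 2 * enorm v ^+ 2)).
have qdq (h : R) : is_derive h 1 q (dq h).
  apply: is_deriveB.
    exact/is_derive_line.
  exact: is_derive_quadratic_poly.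
have [c] : exists2 c, c \in `]0, 1[%R & q 1 - q 0 = dq c * (1 - 0).
  apply: MVT => //.
  apply: derivable_within_continuous => h _.
  by have [] := qdq h.
rewrite in_itv/= => /andP[c0 c1].
rewrite subr0 mulr1 /q /dq scale1r scale0r addr0 => E.
have : dotp (G (t + c *: v) - G t) v <= c * L * enorm v ^+ 2.
  apply: (le_trans (dotp_le_enorm _ _)).
  have := GL (t + c *: v) t; rewrite addrAC subrr add0r enormZ gtr0_norm// => H.
  by have := ler_wpM2r (sqrtr_ge0 (dotp v v)) H; rewrite -/(enorm v); nra.
rewrite dotpBl; nra.
Qed.

End gradients.

(** * Calculus of log-sum-exp *)

Section log_sum_exp.
Context {R : realType} {m : nat} {S : choiceType}.
Variables (w : S -> R) (T : S -> 'rV[R]_m) (s0 : S).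
Hypothesis w_gt0 : forall s, 0 < w s.

(** Serves twice: over [X * Y] for the log-partition function, and over [Y] at fixed [x] for the
    terms of h. In both cases it is convertible to [weight]. *)
Definition tilt (t : 'rV[R]_m) (s : S) : R := w s * expR (dotp t (T s)).

Hypothesis cvg_tilt : forall t, converges (tilt t).

Definition lse (t : 'rV[R]_m) : R := ln (csum (tilt t)).

(** The mean of [dotp v (T s)] under the normalized weights, which is the derivative of [lse] at [t]
    along [v]. *)
Definition tilted_mean (t v : 'rV[R]_m) : R :=
  csum (fun s => tilt t s * dotp v (T s)) / csum (tilt t).

(** The expected sufficient statistic, taken coordinatewise because [csum] sums real families. *)
Definition mean_stat (t : 'rV[R]_m) : 'rV[R]_m :=
  \row_c tilted_mean t (delta_mx 0 c).

Lemma tilt_gt0 t s : 0 < tilt t s.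
Proof. by rewrite mulr_gt0// expR_gt0. Qed.

Lemma csum_tilt_gt0 t : 0 < csum (tilt t).
Proof.
by apply: (@csum_gt0 _ _ _ s0) => // [s|]; rewrite ?ltW// tilt_gt0.
Qed.

Lemma tiltD t v s : tilt (t + v) s = tilt t s * expR (dotp v (T s)).
Proof. by rewrite /tilt dotpDl expRD mulrA. Qed.

(** From |a| <= exp a + exp(-a): multiplying the weights at t by these exponentials gives the
    weights at t + v and t - v, whose sums converge. *)
Lemma converges_tilt_dotp t v : converges (fun s => tilt t s * dotp v (T s)).
Proof.
apply: (converges_le _ (convergesD (cvg_tilt (t + v)) (cvg_tilt (t - v)))) => s.
rewrite !tiltD dotpNl -mulrDr normrM gtr0_norm ?tilt_gt0//.
apply: ler_wpM2l; first exact/ltW/tilt_gt0.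
apply: le_trans (expR_norm_le _).
by apply: le_trans (expR_ge1Dx _); rewrite lerDr.
Qed.

Lemma is_derive_csum_tilt t v :
  is_derive t v (fun t' => csum (tilt t')) (csum (fun s => tilt t s * dotp v (T s))).
Proof.
(* The factors exp(2a) and exp(-2a) of [expR_quadratic] shift the parameter to t + 2v and t - 2v,
   hence this constant. *)
apply: (@is_derive_quadratic _ _ _ _ _ _
  (4 * (csum (tilt (t + 2 *: v)) + csum (tilt (t - 2 *: v))))) => h h1.
have cm := converges_tilt_dotp t v.
have cB := convergesB (cvg_tilt (t + h *: v)) (cvg_tilt t).
have E := csumB cB (convergesZ h cm).
rewrite (csumB (cvg_tilt (t + h *: v)) (cvg_tilt t)) (csumZ h cm) in E.
rewrite -E {E}.
have cD := convergesD (cvg_tilt (t + 2 *: v)) (cvg_tilt (t - 2 *: v)).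
have E := csumZ (4 * h ^+ 2) cD.
rewrite (csumD (cvg_tilt (t + 2 *: v)) (cvg_tilt (t - 2 *: v))) in E.
rewrite mulrAC -E {E}.
have bound s : `|tilt (t + h *: v) s - tilt t s - h * (tilt t s * dotp v (T s))| <=
    4 * h ^+ 2 * (tilt (t + 2 *: v) s + tilt (t - 2 *: v) s).
  rewrite !tiltD dotpNl !dotpZl.
  have -> : tilt t s * expR (h * dotp v (T s)) - tilt t s -
      h * (tilt t s * dotp v (T s)) =
    tilt t s * (expR (h * dotp v (T s)) - 1 - h * dotp v (T s)) by ring.
  rewrite -mulrDr mulrCA normrM gtr0_norm ?tilt_gt0//.
  apply: ler_wpM2l; first exact/ltW/tilt_gt0.
  by rewrite [leRHS]mulrAC; exact: expR_quadratic.
have cD' : converges (fun s => 4 * h ^+ 2 * (tilt (t + 2 *: v) s + tilt (t - 2 *: v) s)).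
  exact: convergesZ.
have cB' := convergesB cB (convergesZ h cm).
rewrite ler_norml -csumN//; apply/andP; split; apply: le_csum => //.
- exact: convergesN.
- by move=> s; have := bound s; rewrite ler_norml => /andP[].
- by move=> s; have := bound s; rewrite ler_norml => /andP[].
Qed.

Lemma tilted_mean_linear t : linear_for *%R (tilted_mean t : 'rV[R]_m -> R).
Proof.
move=> a u v; rewrite /tilted_mean mulrA -mulrDl; congr (_ / _).
have cu := converges_tilt_dotp t u; have cv := converges_tilt_dotp t v.
rewrite -csumZ// -csumD//; last exact: convergesZ.
by congr csum; apply/funext => s; rewrite dotpDl dotpZl; ring.
Qed.

Lemma dotp_mean_stat t v : dotp (mean_stat t) v = tilted_mean t v.
Proof.
pose f := GRing.isLinear.Build R 'rV[R]_m R *%R (tilted_mean t) (tilted_mean_linear t).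
pose F : {linear 'rV[R]_m -> R | *%R} := HB.pack (tilted_mean t) f.
rewrite [v in RHS]row_sum_delta -[RHS]/(F _) linear_sum.
by apply: eq_bigr => c _; rewrite linearZ/= mxE mulrC.
Qed.

Lemma has_gradient_lse : has_gradient lse mean_stat.
Proof.
(* Writing [t] as [t + 0 *: v] brings the goal to the form of [is_derive_line] at parameter 0. *)
move=> t v; rewrite dotp_mean_stat -[t in is_derive t]addr0 -(scale0r v).
apply/is_derive_line.
rewrite /tilted_mean mulrC.
change (is_derive (0 : R) (1 : R) (@ln R \o (fun k : R => csum (tilt (t + k *: v))))
  ((csum (tilt t))^-1 * csum (fun s => tilt t s * dotp v (T s)))).
apply: is_derive1_comp.
  rewrite scale0r addr0; exact/is_derive1_ln/csum_tilt_gt0.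
apply/(is_derive_line (fun t => csum (tilt t))).
rewrite scale0r addr0; exact: is_derive_csum_tilt.
Qed.

(* Jensen's inequality for exp, from exp x >= exp a * (1 + x - a) with a the
   tilted mean. *)
Lemma subgradient_lse : subgradient lse mean_stat.
Proof.
move=> t s; rewrite dotp_mean_stat -lerBrDl /lse.
have s0' := csum_tilt_gt0 s; have t0 := csum_tilt_gt0 t.
set a := tilted_mean t (s - t).
rewrite -ln_div ?posrE// -[a]expRK ler_ln ?posrE ?expR_gt0 ?divr_gt0//.
rewrite ler_pdivlMr// -csumZ//.
have cm := converges_tilt_dotp t (s - t).
(* The added terms [tilt t i * (dotp (s - t) (T i) - a)] sum to zero by the choice of [a]. *)
have -> : csum (fun i => expR a * tilt t i) =
  csum (fun i => expR a * ((1 - a) * tilt t i + tilt t i * dotp (s - t) (T i))).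
  have c1 := convergesZ (1 - a) (cvg_tilt t).
  rewrite !csumZ//; last exact: convergesD.
  rewrite csumD// csumZ//; congr (_ * _).
  have -> : csum (fun i => tilt t i * dotp (s - t) (T i)) = a * csum (tilt t).
    by rewrite /a /tilted_mean divfK// gt_eqF.
  by ring.
apply: le_csum => //.
  by apply: convergesZ; apply: convergesD => //; exact: convergesZ.
move=> i.
have -> : tilt s i = tilt t i * (expR a * expR (dotp (s - t) (T i) - a)).
  by rewrite -expRD addrC subrK -tiltD addrC subrK.
rewrite [leRHS]mulrCA; apply: ler_wpM2l; first exact: expR_ge0.
rewrite mulrC -mulrDr; apply: ler_wpM2l; first exact/ltW/tilt_gt0.
by have := expR_ge1Dx (dotp (s - t) (T i) - a); lra.
Qed.

End log_sum_exp.

(** * Borel measurability on row vectors *)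

Section borel_vectors.
Context {R : realType} {m : nat}.

(** A type of its own, so that row vectors carry the sigma-algebra generated by the open sets, the
    one that [past] and the measurability of the iterates refer to. *)
Definition borel_rV := g_sigma_algebraType (@open 'rV[R]_m).

Lemma continuous_dotp (u : 'rV[R]_m) : continuous (dotp u).
Proof.
rewrite (_ : dotp u = \sum_(c < m) (fun t => u 0 c * t 0 c)); last first.
  by apply/funext => t; rewrite fct_sumE.
elim/big_ind : _ => [|f g cf cg t|c _ t].
  exact: (@cst_continuous _ _ (0 : R)).
  exact: (continuousD (cf t) (cg t)).
exact: (cvgM (cvg_cst (u 0 c)) (@coord_continuous R 1 m 0 c t)).
Qed.

(* A function with a subgradient everywhere is a supremum of affine functions,
   hence lower semicontinuous and Borel, which spares a continuity proof. *)
Lemma open_gt_subgradient (g : 'rV[R]_m -> R) G a :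
  subgradient g G -> open [set t | a < g t].
Proof.
move=> gG; rewrite openE => t /= at_.
pose A (s : 'rV[R]_m) := g t + (dotp (G t) s - dotp (G t) t).
have cA : A s @[s --> t] --> A t.
  exact: (cvgD (cvg_cst (g t))
    (cvgB (@continuous_dotp (G t) t) (cvg_cst (dotp (G t) t)))).
have : \forall s \near t, a < A s.
  by apply: (cvgr_gt _ cA); rewrite /A subrr addr0.
apply: filterS => s /lt_le_trans; apply.
by rewrite /A -dotpBr; exact: gG.
Qed.

Lemma measurable_subgradient (g : 'rV[R]_m -> R) G :
  subgradient g G -> measurable_fun [set: borel_rV] g.
Proof.
move=> gG; apply: (measurability _ (RGenOInfty.measurableE R)).
move=> _ [_ [a ->] <-]; rewrite setTI; apply: sub_sigma_algebra.
by rewrite preimage_itvoy; exact: open_gt_subgradient gG.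
Qed.

Lemma measurable_translation (v : 'rV[R]_m) :
  measurable_fun [set: borel_rV] ((fun t => t + v) : borel_rV -> borel_rV).
Proof.
apply: (@measurability _ _ borel_rV borel_rV _ _ (@open 'rV[R]_m) erefl).
move=> _ [U oU <-]; rewrite setTI.
apply: sub_sigma_algebra; apply: open_comp => // t _.
exact: (cvgD cvg_id (cvg_cst v)).
Qed.

(** The derivative is the pointwise limit of the difference quotients with steps 1/(n+1), each of
    them measurable. *)
Lemma measurable_is_derive (g g' : 'rV[R]_m -> R) v :
  measurable_fun [set: borel_rV] g ->
  (forall t, is_derive t v g (g' t)) -> measurable_fun [set: borel_rV] g'.
Proof.
move=> mg gg'.
pose q (n : nat) (t : borel_rV) : R :=
  (harmonic n)^-1 * (g (t + harmonic n *: v) - g t).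
apply: (@measurable_fun_cvg _ borel_rV R setT q) => [n|t _].
  apply: measurable_funM; first exact: measurable_cst.
  apply: measurable_funB => //.
  exact: (measurableT_comp mg (measurable_translation _)).
have [dg gt] := gg' t.
have : (fun h : R => h^-1 *: ((g \o shift t) (h *: v) - g t)) @ 0^' --> g' t.
  by rewrite -gt; exact: dg.
rewrite (_ : q ^~ t = (fun n =>
    (harmonic n)^-1 *: ((g \o shift t) (harmonic n *: v) - g t))); last first.
  by apply/funext => n; rewrite /q [in LHS](addrC t).
move=> /cvgr_dnbhsP/(_ harmonic); apply; split; last exact: cvg_harmonic.
by move=> n; rewrite gt_eqF ?harmonic_gt0.
Qed.

End borel_vectors.
Arguments borel_rV : clear implicits.

(** * Independence of the draw from the current iterate *)

Section independence.
Context {d : measure_display} {Omega : measurableType d} {R : realType}.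
Context (P : probability Omega R) {m n : nat}.
Variables (theta : nat -> Omega -> 'rV[R]_m) (draw : nat -> Omega -> 'I_n).

Lemma past_theta k (A : set (borel_rV R m)) : (0 < k)%N -> measurable A ->
  past theta draw k (theta k @^-1` A).
Proof.
move=> k0 mA; rewrite /past; set E := [set B | _].
suff mt : measurable_fun [set: g_sigma_algebraType E]
    (theta k : g_sigma_algebraType E -> borel_rV R m).
  by have := mt measurableT A mA; rewrite setTI.
apply: (@measurability _ _ _ (borel_rV R m) _ _ (@open 'rV[R]_m) erefl).
move=> _ [U oU <-]; rewrite setTI.
by apply: sub_sigma_algebra; left; exists k, U; split=> //; rewrite k0 leqnn.
Qed.

(** Independence is given for events only. It says that P restricted to the draw event and c times P
    have the same image under [theta k]; equal measures then give equal integrals of [g]. *)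
Lemma integral_indep_draw (c : R) k j (g : borel_rV R m -> R) : (0 < k)%N ->
    0 <= c ->
    measurable_fun [set: Omega] (theta k : Omega -> borel_rV R m) ->
    measurable (draw k @^-1` [set j]) ->
    P (draw k @^-1` [set j]) = c%:E ->
    (forall A, past theta draw k A ->
      P (A `&` draw k @^-1` [set j]) = (P A * P (draw k @^-1` [set j]))%E) ->
    measurable_fun setT g -> (forall t, 0 <= g t) ->
  (\int[P]_(w in draw k @^-1` [set j]) (g (theta k w))%:E =
   c%:E * \int[P]_w (g (theta k w))%:E)%E.
Proof.
move=> k0 c0 mt mD PD indep mg g0.
set D := draw k @^-1` [set j] in mD PD indep *.
have mgt : measurable_fun setT (fun w => (g (theta k w))%:E).
  by apply/measurable_EFinP; exact: measurableT_comp mg mt.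
have mg' : measurable_fun setT (fun t : borel_rV R m => (g t)%:E).
  exact/measurable_EFinP.
have gt0 w : (0 <= (g (theta k w))%:E)%E by rewrite lee_fin.
(* The complement of D is null for the restricted measure, so the integral may extend over the whole
   space. *)
transitivity (\int[mrestr P mD]_w (g (theta k w))%:E)%E.
  rewrite (@ge0_negligible_integral _ _ _ (mrestr P mD) setT (~` D))//; first last.
  - by rewrite /= /mrestr setICl measure0.
  - exact: measurableC.
  rewrite setTD setCK; apply: eq_measure_integral => A mA AD.
  by rewrite /= /mrestr (setIidl AD).
(* Naming the image measure keeps its measure structure at hand while its values remain available by
   rewriting. *)
have push (mu : {measure set Omega -> \bar R}) :
    exists nu : {measure set (borel_rV R m) -> \bar R},
      nu = pushforward mu (theta k : Omega -> borel_rV R m) :> (set _ -> \bar R).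
  by exists (measure_function_pushforward__canonical__measure_function_Measure mu mt).
have [nuD nuDE] := push (mrestr P mD); have [nu nuE] := push P.
transitivity (\int[nuD]_t (g t)%:E)%E.
  by rewrite nuDE (ge0_integral_pushforward mt)// => t _; rewrite lee_fin.
transitivity (\int[mscale (NngNum c0) nu]_t (g t)%:E)%E.
  apply: eq_measure_integral => A mA _.
  have indepA := indep _ (past_theta k0 mA).
  transitivity (P (theta k @^-1` A `&` D)); first by rewrite nuDE.
  rewrite indepA PD muleC.
  transitivity (c%:E * nu A)%E; last by [].
  by rewrite nuE.
rewrite ge0_integral_mscale//; last by move=> t _; rewrite lee_fin.
by rewrite nuE (ge0_integral_pushforward mt)// => t _; rewrite lee_fin.
Qed.

End independence.

(** * From pathwise descent to expectations *)

Section randomized_descent.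
Context {R : realType} {m n : nat} (block : 'I_m -> 'I_n).

Definition block_sqr (j : 'I_n) (u : 'rV[R]_m) : R :=
  \sum_(c | block c == j) u 0 c ^+ 2.

Lemma block_sqr_ge0 j u : 0 <= block_sqr j u.
Proof. by apply: sumr_ge0 => c _; exact: sqr_ge0. Qed.

Lemma sum_block_sqr u : \sum_j block_sqr j u = enorm u ^+ 2.
Proof. by rewrite enorm_sqr /dotp (partition_big block xpredT). Qed.

Lemma measurable_block_sqr (G : borel_rV R m -> 'rV[R]_m) j :
  (forall c, measurable_fun setT (fun t => G t 0 c)) ->
  measurable_fun setT (fun t => block_sqr j (G t)).
Proof.
move=> mG; rewrite /block_sqr.
under eq_fun do rewrite big_mkcond.
apply: measurable_sum => c; case: (block c == j); last exact: measurable_cst.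
exact: measurable_funX.
Qed.

Context {d : measure_display} {Omega : measurableType d}.
Context (P : probability Omega R).

(** Split the space by the value j of the draw. By independence each piece contributes 1/n times the
    expected squared norm of block j, and these blocks add up to the full squared norm. The same
    splitting gives measurability. *)
Lemma expectation_enorm_draw (G : 'rV[R]_m -> 'rV[R]_m)
    (theta : nat -> Omega -> 'rV[R]_m) (draw : nat -> Omega -> 'I_n) k :
    (0 < n)%N -> (0 < k)%N ->
    (forall c, measurable_fun [set: borel_rV R m] (fun t => G t 0 c)) ->
    measurable_fun [set: Omega] (theta k : Omega -> borel_rV R m) ->
    (forall j, measurable (draw k @^-1` [set j])) ->
    (forall j, P (draw k @^-1` [set j]) = (n%:R^-1)%:E) ->
    (forall j A, past theta draw k A ->
      P (A `&` draw k @^-1` [set j]) = (P A * P (draw k @^-1` [set j]))%E) ->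
  measurable_fun setT (fun w => (block_sqr (draw k w) (G (theta k w)))%:E) /\
  ('E_P[fun w => (enorm (G (theta k w)) ^+ 2)%R] =
   n%:R%:E * \int[P]_w (block_sqr (draw k w) (G (theta k w)))%:E)%E.
Proof.
move=> n0 k0 mG mt mD PD indep.
pose B j w := (block_sqr j (G (theta k w)))%:E.
pose D j := draw k @^-1` [set j].
have mB j : measurable_fun setT (B j).
  apply/measurable_EFinP.
  exact: (measurableT_comp (measurable_block_sqr j mG) mt).
have B0 j w : (0 <= B j w)%E by rewrite lee_fin block_sqr_ge0.
have mBD j : measurable_fun setT (B j \_ (D j)).
  by apply/(measurable_restrictT _ (mD j)).1; exact: (measurable_funTS (mB j)).
have BD0 j w : (0 <= (B j \_ (D j)) w)%E by apply: erestrict_ge0.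
have E w : (block_sqr (draw k w) (G (theta k w)))%:E = (\sum_j (B j \_ (D j)) w)%E.
  rewrite (bigD1 (draw k w))//= big1 ?adde0 => [|j jw].
    by rewrite patchE mem_set.
  by rewrite patchE memNset// /D /= => wj; rewrite wj eqxx in jw.
split.
  by under eq_fun do rewrite E; exact: emeasurable_sum.
under [in RHS]eq_integral do rewrite E.
rewrite ge0_integral_sum// ge0_sume_distrr; last by move=> j _; exact: integral_ge0.
rewrite unlock.
under eq_integral do rewrite -sum_block_sqr -sumEFin.
rewrite ge0_integral_sum//; last by move=> j w _; exact: B0.
apply: eq_bigr => j _; rewrite -integral_mkcond.
rewrite (integral_indep_draw k0 _ mt (mD j) (PD j) (indep j)
  (measurable_block_sqr j mG)) ?invr_ge0//; last first.
  by move=> t; exact: block_sqr_ge0.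
by rewrite muleA -EFinM divff ?mul1e// pnatr_eq0 -lt0n.
Qed.

(** The sum telescopes for each outcome before integration, so that only nonnegative functions
    bounded by a constant are integrated there. *)
Lemma sum_expectation_enorm_le (F : 'rV[R]_m -> R) (G : 'rV[R]_m -> 'rV[R]_m)
    (theta : nat -> Omega -> 'rV[R]_m) (draw : nat -> Omega -> 'I_n)
    (K : nat) (L Fmin F1 : R) :
    (0 < n)%N -> 0 <= L -> (forall t, Fmin <= F t) ->
    (forall w, F (theta 1%N w) = F1) ->
    (forall c, measurable_fun [set: borel_rV R m] (fun t => G t 0 c)) ->
    (forall k, (1 <= k <= K)%N ->
      measurable_fun [set: Omega] (theta k : Omega -> borel_rV R m)) ->
    (forall k j, (1 <= k <= K)%N -> measurable (draw k @^-1` [set j])) ->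
    (forall k j, (1 <= k <= K)%N -> P (draw k @^-1` [set j]) = (n%:R^-1)%:E) ->
    (forall k j A, (1 <= k <= K)%N -> past theta draw k A ->
      P (A `&` draw k @^-1` [set j]) = (P A * P (draw k @^-1` [set j]))%E) ->
    (forall k w, (1 <= k <= K)%N ->
      block_sqr (draw k w) (G (theta k w)) <=
      2 * L * (F (theta k w) - F (theta k.+1 w))) ->
  (\sum_(1 <= k < K.+1) 'E_P[fun w => (enorm (G (theta k w)) ^+ 2)%R]
   <= (2 * n%:R * L * (F1 - Fmin))%:E)%E.
Proof.
move=> n0 L0 Fm F1E mG mt mD PD indep desc.
pose B k w := (block_sqr (draw k w) (G (theta k w)))%:E.
have step k : (1 <= k <= K)%N -> measurable_fun setT (B k) /\
    ('E_P[fun w => (enorm (G (theta k w)) ^+ 2)%R] = n%:R%:E * \int[P]_w (B k w))%E.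
  move=> kK; have /andP[k0 _] := kK.
  exact: (expectation_enorm_draw n0 k0 mG (mt k kK) (fun j => mD k j kK)
    (fun j => PD k j kK) (fun j A => indep k j A kK)).
have B0 k w : (0 <= B k w)%E by rewrite lee_fin block_sqr_ge0.
under eq_big_nat => k kK do rewrite (step k kK).2.
rewrite -ge0_sume_distrr; last by move=> k _; exact: integral_ge0.
have -> : (\sum_(1 <= k < K.+1) \int[P]_w (B k w) =
           \int[P]_w \sum_(k < K) B k.+1 w)%E.
  rewrite ge0_integral_sum// => [|k]; last by case: (step k.+1); rewrite ?ltn_ord.
  by rewrite big_add1 big_mkord.
have -> : (2 * n%:R * L * (F1 - Fmin))%:E =
    (n%:R%:E * \int[P]_w (2 * L * (F1 - Fmin))%:E)%E.
  rewrite integral_cst//= probability_setT mule1 -EFinM; congr EFin; ring.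
apply: lee_wpmul2l; first by rewrite lee_fin.
(* The index is shifted by one: k < K stands for iteration k+1. What is left is F at the iterates 1
   and K+1, the latter bounded below by [Fmin]. *)
have Fdec w : (\sum_(k < K) B k.+1 w <= (2 * L * (F1 - Fmin))%:E)%E.
  rewrite sumEFin lee_fin.
  apply: (@le_trans _ _ (\sum_(k < K) 2 * L * (F (theta k.+1 w) - F (theta k.+2 w)))).
    by apply: ler_sum => k _; apply: desc; rewrite ltn_ord.
  rewrite -mulr_sumr; apply: ler_wpM2l; first by rewrite mulr_ge0.
  rewrite -(big_mkord xpredT (fun k => F (theta k.+1 w) - F (theta k.+2 w))).
  under eq_bigr do rewrite -opprB.
  rewrite sumrN telescope_sumr// opprB F1E.
  by rewrite lerB.
apply: ge0_le_integral => //.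
- by move=> w _; apply: sume_ge0 => k _.
- by apply: emeasurable_sum => k; case: (step k.+1); rewrite ?ltn_ord.
Qed.

End randomized_descent.

(** * Descent along one block EM step *)

(** The arithmetic of one step. Here e0, e, e' are the values of the M-step objective, and f0, f, f'
    those of f, at the current point, the gradient step and the minimizer; h and h' are the values
    of h at the first and the last. The numbers p and q pair the gradient of h with the two
    displacements, r pairs that of f with the gradient step, and y is the quadratic term. *)
Lemma sufficient_decrease (R : realFieldType)
    (e e' e0 f f' f0 h h' p q r x y : R) :
    e' - e0 = f' - f0 - p -> e - e0 = f - f0 - q -> e' <= e ->
    f <= f0 + r + y -> h + p <= h' -> r - q = - x ->
  x - y <= f0 - h - (f' - h').
Proof. by lra. Qed.

Section block_part.
Context {R : realType} {m n : nat} (block : 'I_m -> 'I_n).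
Implicit Types (j : 'I_n) (u : 'rV[R]_m).

Definition block_part j u : 'rV[R]_m :=
  \row_c (if block c == j then u 0 c else 0).

Lemma dotp_block_part j u : dotp u (block_part j u) = block_sqr block j u.
Proof.
rewrite /dotp /block_sqr [RHS]big_mkcond; apply: eq_bigr => c _.
by rewrite mxE; case: ifP => _; rewrite ?mulr0// expr2.
Qed.

Lemma enorm_block_part j u : enorm (block_part j u) ^+ 2 = block_sqr block j u.
Proof.
rewrite enorm_sqr /dotp /block_sqr [RHS]big_mkcond; apply: eq_bigr => c _.
by rewrite mxE; case: ifP => _; rewrite ?mulr0// expr2.
Qed.

End block_part.

Section block_em.
Context {R : realType} {m : nat} {X Y : countType}.
Variables (phi : X -> Y -> R) (stat : X -> Y -> 'rV[R]_m).
Variables (N : nat) (data : N.-tuple X) (x0 : X) (y0 : Y).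
Hypothesis phi_gt0 : forall x y, 0 < phi x y.
Hypothesis cvg_partition : forall t : 'rV[R]_m,
  converges (fun xy : X * Y => weight phi stat t xy.1 xy.2).

Let log_partition : 'rV[R]_m -> R :=
  lse (fun xy : X * Y => phi xy.1 xy.2) (fun xy => stat xy.1 xy.2).
Let log_slice (x : X) : 'rV[R]_m -> R := lse (phi x) (stat x).

Let cvg_weight t x : converges (weight phi stat t x).
Proof. exact: (converges_slice x (cvg_partition t)). Qed.

Let phi2_gt0 (xy : X * Y) : 0 < phi xy.1 xy.2.
Proof. exact: phi_gt0. Qed.

Let partition_gt0 t : 0 < partition_function phi stat t.
Proof.
exact: (csum_tilt_gt0 (x0, y0) phi2_gt0 cvg_partition).
Qed.

Let slice_gt0 t x : 0 < csum (weight phi stat t x).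
Proof. exact: (csum_tilt_gt0 y0 (phi_gt0 x) (cvg_weight ^~ x)). Qed.

(* [hlog] is the function h of the decomposition L = f - h. *)
Definition hlog (t : 'rV[R]_m) : R := \sum_(x <- data) log_slice x t.

Definition hlog_grad (t : 'rV[R]_m) : 'rV[R]_m :=
  \sum_(x <- data) mean_stat (phi x) (stat x) t.

Definition flog_grad (t : 'rV[R]_m) : 'rV[R]_m :=
  N%:R *: mean_stat (fun xy : X * Y => phi xy.1 xy.2) (fun xy => stat xy.1 xy.2) t.

Lemma marginalE t x : marginal phi stat t x =
  csum (weight phi stat t x) / partition_function phi stat t.
Proof.
rewrite mulrC -(csumZ _ (cvg_weight t x)).
by congr csum; apply/funext => y; rewrite /joint mulrC.
Qed.

(** The partition function cancels, leaving the weights at fixed [x] normalized by their sum. *)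
Lemma posteriorE t x y : posterior phi stat t x y =
  (csum (weight phi stat t x))^-1 * weight phi stat t x y.
Proof.
rewrite /posterior marginalE /joint.
have := partition_gt0 t; have := slice_gt0 t x.
set z := partition_function _ _ _; set s := csum _ => s0 z0.
by field; rewrite !gt_eqF.
Qed.

Lemma ln_jointE t x y : ln (joint phi stat t x y) =
  ln (phi x y) + dotp t (stat x y) - log_partition t.
Proof.
rewrite /joint ln_div ?posrE ?mulr_gt0 ?expR_gt0//.
by rewrite lnM ?posrE ?expR_gt0// expRK.
Qed.

Lemma nllE t : nll phi stat data t = flog phi stat N t - hlog t.
Proof.
rewrite /nll /hlog /flog -sumrN.
have -> : N%:R * ln (partition_function phi stat t) =
    \sum_(x <- data) ln (partition_function phi stat t).
  by rewrite big_const_seq count_predT size_tuple iter_addr_0 mulr_natl.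
rewrite -sumrB; apply: eq_bigr => x _.
by rewrite marginalE ln_div ?posrE// opprB.
Qed.

Lemma has_gradient_flog : has_gradient (flog phi stat N) flog_grad.
Proof.
apply: has_gradientZ.
exact: (has_gradient_lse (x0, y0) phi2_gt0 cvg_partition).
Qed.

Lemma has_gradient_hlog : has_gradient hlog hlog_grad.
Proof.
apply: has_gradient_sum => x.
exact: (has_gradient_lse y0 (phi_gt0 x) (cvg_weight ^~ x)).
Qed.

Lemma has_gradient_nll :
  has_gradient (nll phi stat data) (fun t => flog_grad t - hlog_grad t).
Proof.
rewrite (_ : nll phi stat data = (fun t => flog phi stat N t - hlog t)).
  exact: has_gradientB has_gradient_flog has_gradient_hlog.
by apply/funext => t; exact: nllE.
Qed.

(** Serves the measurability of [nll], which is obtained from f and h separately. *)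
Lemma subgradient_flog : subgradient (flog phi stat N) flog_grad.
Proof.
apply: subgradientZ => //.
exact: (subgradient_lse (x0, y0) phi2_gt0 cvg_partition).
Qed.

Lemma subgradient_hlog : subgradient hlog hlog_grad.
Proof.
apply: subgradient_sum => x.
exact: (subgradient_lse y0 (phi_gt0 x) (cvg_weight ^~ x)).
Qed.

Lemma measurable_nll : measurable_fun [set: borel_rV R m] (nll phi stat data).
Proof.
rewrite (_ : nll phi stat data = (fun t => flog phi stat N t - hlog t)).
  apply: measurable_funB.
    exact: measurable_subgradient subgradient_flog.
  exact: measurable_subgradient subgradient_hlog.
by apply/funext => t; exact: nllE.
Qed.

(** In the difference of log-likelihoods the base measure cancels, leaving the statistic paired with
    s - t minus the increment of the log-partition function. The posterior mean of the statistic at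
    [x] is the gradient of the corresponding term of h. *)
Lemma em_objectiveB t s :
    (forall s' x, x \in data ->
      converges (fun y => posterior phi stat t x y * ln (joint phi stat s' x y))) ->
  em_objective phi stat data t s - em_objective phi stat data t t =
  flog phi stat N s - flog phi stat N t - dotp (hlog_grad t) (s - t).
Proof.
move=> cvg_obj.
have E x : x \in data ->
    csum (fun y => posterior phi stat t x y * ln (joint phi stat s x y)) -
    csum (fun y => posterior phi stat t x y * ln (joint phi stat t x y)) =
    dotp (mean_stat (phi x) (stat x) t) (s - t) - (log_partition s - log_partition t).
  move=> xd; rewrite -(csumB (cvg_obj s x xd) (cvg_obj t x xd)).
  rewrite (dotp_mean_stat (phi_gt0 x) (cvg_weight ^~ x)).
  have cm := converges_tilt_dotp (phi_gt0 x) (cvg_weight ^~ x) t (s - t).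
  have cw := convergesZ (log_partition s - log_partition t) (cvg_weight t x).
  transitivity ((csum (weight phi stat t x))^-1 *
    csum (fun y => tilt (phi x) (stat x) t y * dotp (s - t) (stat x y) -
      (log_partition s - log_partition t) * weight phi stat t x y)).
    rewrite -(csumZ _ (convergesB cm cw)); congr csum; apply/funext => y.
    rewrite posteriorE !ln_jointE dotpBl.
    have alg (w W l ls lt ds dt : R) : W * w * (l + ds - ls) - W * w * (l + dt - lt) =
      W * (w * (ds - dt) - (ls - lt) * w) by ring.
    exact: alg.
  rewrite (csumB cm cw) (csumZ _ (cvg_weight t x)) /tilted_mean mulrBr.
  congr (_ - _); first by rewrite mulrC.
  by rewrite mulrCA mulVf ?mulr1// gt_eqF.
rewrite /em_objective opprK addrC -sumrB.
under eq_big_seq => x xd.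
  rewrite -opprB E// opprB.
  over.
rewrite sumrB.
have -> : dotp (hlog_grad t) (s - t) =
    \sum_(x <- data) dotp (mean_stat (phi x) (stat x) t) (s - t).
  rewrite /hlog_grad; elim: (tval data) => [|x r IH]; first by rewrite !big_nil dotp0l.
  by rewrite !big_cons dotpDl IH.
congr (_ - _); rewrite /flog -mulrBr.
by rewrite big_const_seq count_predT size_tuple iter_addr_0 mulr_natl.
Qed.

Lemma block_em_step_descent n (block : 'I_m -> 'I_n) j L t t' :
    0 <= L -> lipschitz_gradient L (flog phi stat N) ->
    (forall s' x, x \in data ->
      converges (fun y => posterior phi stat t x y * ln (joint phi stat s' x y))) ->
    block_em_step phi stat data block j t t' ->
  block_sqr block j (grad (nll phi stat data) t) <=
  2 * L * (nll phi stat data t - nll phi stat data t').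
Proof.
move=> L0 L_smooth cvg_obj [_ t'_min].
rewrite (has_gradient_grad _ has_gradient_nll).
set G := _ - _; set B := block_sqr block j G; set D := nll _ _ _ t - _.
(* The step length stays free, since 1/L is meaningless for L = 0. *)
have step a : a * B - L / 2 * (a ^+ 2 * B) <= D.
  (* A gradient step within the block, hence a competitor of the exact minimizer. *)
  pose v := - a *: block_part block j G.
  have Gv : dotp G v = - (a * B) by rewrite dotpZr dotp_block_part mulNr.
  have vv : enorm v ^+ 2 = a ^+ 2 * B.
    by rewrite enormZ exprMn enorm_block_part normrN real_normK ?num_real.
  have tv : same_outside block j t (t + v).
    by move=> c /negPf cj; rewrite mxE mxE mxE cj mulr0 addr0.
  have flog_smooth s s' :
      enorm (flog_grad s - flog_grad s') <= L * enorm (s - s').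
    have := L_smooth s s'.
    by rewrite !(has_gradient_grad _ has_gradient_flog).
  have descent := descent_lemma L0 has_gradient_flog flog_smooth t v.
  have convex := subgradient_hlog t t'.
  rewrite vv in descent; rewrite dotpBl in Gv; rewrite /D !nllE.
  have tvt : t + v - t = v by rewrite addrC addKr.
  have E2 := em_objectiveB (t + v) cvg_obj; rewrite tvt in E2.
  rewrite mulrA; rewrite mulrA in descent.
  exact: (sufficient_decrease (em_objectiveB t' cvg_obj) E2 (t'_min _ tv)
    descent convex Gv).
have B0 : 0 <= B by exact: block_sqr_ge0.
move: L0; rewrite le_eqVlt => /predU1P[L0|L0].
  have [->|Bn0] := eqVneq B 0; first by rewrite -L0 mulr0 mul0r.
  have Bgt0 : 0 < B by rewrite lt_def Bn0.
  (* For L = 0 the bound reads a B <= D for every a; this choice of a would give D + 1 <= D. *)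
  have := step ((D + 1) / B); rewrite -L0 !mul0r subr0 divfK//.
  by rewrite gerDl ler10.
(* The length 1/L maximizes a - L a^2 / 2, with value 1/(2L). *)
have := step (L^-1).
have -> : L^-1 * B - L / 2 * (L^-1 ^+ 2 * B) = (2 * L)^-1 * B.
  by field; rewrite gt_eqF.
by rewrite ler_pdivrMl// mulr_gt0.
Qed.

End block_em.

(** * Minimum against mean, and the conclusion *)

Lemma bigmin_le_mean (R : realType) (K : nat) (e : nat -> \bar R) (c : R) :
  (0 < K)%N -> (\sum_(1 <= k < K.+1) e k <= c%:E)%E ->
  (\big[Order.min/+oo]_(1 <= k < K.+1) e k <= (c / K%:R)%:E)%E.
Proof.
move=> K0 ec; set mn := \big[_/_]_(_ <= _ < _) _.
have K0' : 0 < K%:R :> R by rewrite ltr0n.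
have mne k : (1 <= k < K.+1)%N -> (mn <= e k)%E.
  by move=> kK; apply: bigmin_inf_seq (lexx _) => //; rewrite mem_index_iota.
(* Only real lower bounds are compared with the mean. If the minimum were [+oo], every real would be
   one, and c/K + 1 gives a contradiction. *)
have real_le r : (r%:E <= mn)%E -> r <= c / K%:R.
  move=> rmn; rewrite ler_pdivlMr// -lee_fin; apply: le_trans ec.
  have -> : (r * K%:R)%:E = (\sum_(1 <= k < K.+1) r%:E)%E.
    by rewrite sumEFin sumr_const_nat subSS subn0 mulr_natr.
  rewrite big_nat [leRHS]big_nat; apply: lee_sum => k kK.
  exact: le_trans rmn (mne k kK).
case: mn real_le {mne} => [r|H|_]; [|exfalso|exact: leNye].
  by move=> /(_ r (lexx _)) H; rewrite lee_fin.
by have := H (c / K%:R + 1) (leey _); rewrite gerDl ler10.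
Qed.

(** Supplies the nonnegative constant that the descent lemma asks for, as the sign of [L] is not
    given. *)
Lemma lipschitz_gradient_max0 (R : realType) (m : nat) (L : R)
    (g : 'rV[R]_m -> R) :
  lipschitz_gradient L g -> lipschitz_gradient (Num.max L 0) g.
Proof.
move=> gL s t; apply: (le_trans (gL s t)); apply: ler_wpM2r.
  exact: sqrtr_ge0.
by rewrite le_max lexx.
Qed.

(* A negative Lipschitz constant forces dimension 0. *)
Lemma lipschitz_gradient_lt0 (R : realType) (m : nat) (L : R)
    (g : 'rV[R]_m -> R) (s t : 'rV[R]_m) :
  lipschitz_gradient L g -> L < 0 -> s = t.
Proof.
move=> gL L0.
have [] := (ltP 0 (enorm (s - t)), gL s t) => -[st|st].
  move=> /(le_trans (sqrtr_ge0 _)); rewrite leNgt nmulr_rlt0//.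
  by rewrite st.
move=> _.
have : dotp (s - t) (s - t) = 0.
  by rewrite -enorm_sqr (le_anti (introT andP (conj st (sqrtr_ge0 _)))) expr0n.
by move/dotpp_eq0/eqP; rewrite subr_eq0 => /eqP.
Qed.

(** The expectations are extended reals, so the minimum has neutral element [+oo], and the bound
    includes that some expectation is finite. [cvg_objective] belongs to the standing assumption
    that the sums involved converge. *)
Theorem corollary8 (R : realType) (m : nat) (X Y : countType)
    (phi : X -> Y -> R) (stat : X -> Y -> 'rV[R]_m)
    (N : nat) (data : N.-tuple X)
    (phi_gt0 : forall x y, 0 < phi x y)
    (cvg_partition : forall t : 'rV[R]_m,
      converges (fun xy : X * Y => weight phi stat t xy.1 xy.2))
    (cvg_objective : forall (t s : 'rV[R]_m) x, x \in data ->
      converges (fun y => posterior phi stat t x y * ln (joint phi stat s x y)))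
    (L : R) (L_smooth : lipschitz_gradient L (flog phi stat N))
    (theta_star : 'rV[R]_m)
    (theta_star_min : forall t : 'rV[R]_m,
      nll phi stat data theta_star <= nll phi stat data t)
    (n : nat) (n_gt0 : (0 < n)%N) (block : 'I_m -> 'I_n)
    (d : measure_display) (Omega : measurableType d) (P : probability Omega R)
    (K : nat) (K_gt0 : (0 < K)%N) (theta1 : 'rV[R]_m)
    (theta : nat -> Omega -> 'rV[R]_m) (draw : nat -> Omega -> 'I_n)
    (run : block_em_run P phi stat data block K theta1 theta draw) :
  (\big[Order.min/+oo]_(1 <= k < K.+1)
      'E_P[fun w => (enorm (grad (nll phi stat data) (theta k w)) ^+ 2)%R]
   <= (2 * n%:R * L / K%:R
       * (nll phi stat data theta1 - nll phi stat data theta_star))%:E)%E.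
Proof.
have [start mtheta mdraw unif indep emstep] := run.
set g := nll phi stat data in theta_star_min *.
set L' := Num.max L 0.
have L'0 : 0 <= L' by rewrite le_max lexx orbT.
(* What the probabilistic part asks of [nll], isolated so that the degenerate cases can be settled
   separately. *)
pose regular :=
  (forall c, measurable_fun [set: borel_rV R m] (fun t => grad g t 0 c)) /\
  (forall k w, (1 <= k <= K)%N ->
    block_sqr block (draw k w) (grad g (theta k w)) <=
    2 * L' * (g (theta k w) - g (theta k.+1 w))).
have [mG desc] : regular.
  (* With no data, or no hidden value (where marginal = 0 and ln 0 = 0), nll is
     identically 0. *)
  have trivial_case : g = cst 0 -> regular.
    move=> g0; have G0 t c : grad g t 0 c = 0 by rewrite mxE g0 derive_cst.
    split=> [c|k w _]; first by under eq_fun do rewrite G0; exact: measurable_cst.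
    rewrite /block_sqr big1 => [|c _]; last by rewrite G0 expr0n.
    by rewrite g0 subrr mulr0.
  have [[y0]|noY] := pselect (inhabited Y); last first.
    apply: trivial_case; apply/funext => t; rewrite /g /nll big1 ?oppr0// => x _.
    rewrite (_ : marginal _ _ _ _ = 0) ?ln0//.
    rewrite /marginal csum_ge0E => [|y]; last by case: noY.
    by rewrite esum1// => y; case: noY.
  have [N0|] := posnP N.
    apply: trivial_case; apply/funext => t; rewrite /g /nll.
    by rewrite big_tuple; clear -N0; subst N; rewrite big_ord0 oppr0.
  move=> Ngt0; pose x0 := tnth data (Ordinal Ngt0).
  have gG := has_gradient_nll data x0 y0 phi_gt0 cvg_partition.
  split=> [c|k w kK].
    apply: (@measurable_is_derive _ _ g _ (delta_mx 0 c)).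
      exact: (measurable_nll data x0 y0 phi_gt0 cvg_partition).
    by move=> t; rewrite (has_gradient_grad t gG) -dotp_delta dotpC; exact: gG.
  exact: (block_em_step_descent x0 y0 phi_gt0 cvg_partition L'0
    (lipschitz_gradient_max0 L_smooth) (cvg_objective (theta k w)) (emstep k w kK)).
have mt k : (1 <= k <= K)%N ->
    measurable_fun [set: Omega] (theta k : Omega -> borel_rV R m).
  move=> /andP[k1 kK].
  apply: (@measurability _ _ _ (borel_rV R m) _ _ (@open 'rV[R]_m) erefl).
  move=> _ [U oU <-].
  by rewrite setTI; apply: mtheta => //; rewrite k1 leqW.
have F1E w : g (theta 1%N w) = g theta1 by rewrite start.
have := sum_expectation_enorm_le n_gt0 L'0 theta_star_min F1E mG mt
  (fun k j => mdraw k j) (fun k j => unif k j) (fun k j A => indep k j A) desc.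
move=> /(bigmin_le_mean K_gt0).
(* For L >= 0 the two constants agree. For L < 0 all points coincide, so both bounds are zero. *)
rewrite mulrAC; have [L0|L0] := leP 0 L; first by rewrite /L' max_l.
by rewrite (lipschitz_gradient_lt0 theta1 theta_star L_smooth L0) subrr !mulr0.
Qed.
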